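(* There is an absolute constant $C>0$ such that for all sufficiently large $n$ and all positive integers $k\le n$, there exists a probability distribution over permutations of $[n]$ with Shannon entropy at most $C\log\log n$ that satisfies the $(k,\delta)$-uniform-induced-ordering property with $\delta=\frac{Ck^2}{\log\log\log n}$.
   Context: $(k,\delta)$-uniform-induced-ordering property of a distribution over permutations $\pi$ of $[n]$ (where $\pi(i)$ is the position of item $i$): for every $k$ distinct items $y_1,\dots,y_k\in[n]$, $\Pr[\pi(y_1)<\dots<\pi(y_k)]\ge(1-\delta)/k!$. Entropy is measured in bits. *)

(* Defs.v *)
From mathcomp Require Import all_boot all_order all_algebra perm.
From mathcomp Require Import reals exp.

Set Implicit Arguments.
Unset Strict Implicit.
Unset Printing Implicit Defensive.

Import Order.TTheory GRing.Theory Num.Theory.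

Local Open Scope ring_scope.

Definition log2 (R : realType) (x : R) : R := ln x / ln 2.

Definition is_distribution (R : realType) (T : finType) (p : T -> R) : Prop :=
  (forall t, 0 <= p t) /\ \sum_(t : T) p t = 1.

Definition Pr (R : realType) (T : finType) (p : T -> R) (E : pred T) : R :=
  \sum_(t : T | E t) p t.

(* Entropy in bits; the term of an outcome t with p t = 0 is 0. *)
Definition entropy (R : realType) (T : finType) (p : T -> R) : R :=
  - \sum_(t : T) p t * log2 (p t).

(* s i is the position of item i: the event is s y_1 < ... < s y_k. *)
Definition induces_order (n k : nat) (y : k.-tuple 'I_n) : pred 'S_n :=
  fun s => sorted ltn [seq nat_of_ord (s i) | i <- y].

Definition uniform_induced_ordering (R : realType) (n k : nat) (delta : R)
    (p : 'S_n -> R) : Prop :=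
  forall y : k.-tuple 'I_n, uniq y ->
    (1 - delta) / (k`!)%:R <= Pr p (induces_order y).

(* Main.v *)
(** The distribution is uniform over a multiset of [M] permutations with [M]
    polynomial in [log n], so its entropy is at most [log2 M = O(log log n)].
    Such a multiset exists by the probabilistic method.  A uniformly random
    permutation induces a given order on [k] items with probability [1 / k!], so
    by a Chernoff bound [M] independent ones fail the [(1 - d) / k!] threshold
    with probability at most [exp (- M d^2 / (4 k!))], and there are only [n^k]
    tuples of items.  The claim is void unless [d < 1], i.e. unless
    [k^2 = O(log log log n)]; then [k! <= 2^(k^2) <= log log n], and
    [M = O((log n)^5)] is enough. *)

Require Import Defs.
From mathcomp Require Import all_boot all_order all_algebra perm.
From mathcomp Require Import reals exp.
From mathcomp Require Import sequences lra ring.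

Set Implicit Arguments.
Unset Strict Implicit.
Unset Printing Implicit Defensive.

Import Order.TTheory GRing.Theory Num.Theory.

Local Open Scope ring_scope.

(** * Counting the permutations that induce a given order *)

(** Send the entries of [z] to those of [y] position by position and fix everything else; as [y] and
    [z] have the same elements, this is injective. *)
Lemma exists_perm_map (T : finType) (y z : seq T) : uniq y -> perm_eq z y ->
  exists t : {perm T}, [seq t x | x <- z] = y.
Proof.
move=> uy zy.
have uz : uniq z by rewrite (perm_uniq zy).
have szy : size z = size y := perm_size zy.
pose f x := if x \in z then nth x y (index x z) else x.
have f_in x : (f x \in y) = (x \in z).
  rewrite /f; case: ifP => xz; last by rewrite -(perm_mem zy).
  by rewrite mem_nth // -szy index_mem.
have f_inj : injective f.
  move=> x1 x2 e; have e12 : (x1 \in z) = (x2 \in z) by rewrite -!f_in e.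
  case: (boolP (x1 \in z)) => x1z; last first.
    by move: e; rewrite /f -e12 (negbTE x1z).
  have x2z : x2 \in z by rewrite -e12.
  move: e; rewrite /f x1z x2z (set_nth_default x2) -?szy ?index_mem //.
  move/eqP; rewrite nth_uniq -?szy ?index_mem // => /eqP e.
  by rewrite -(nth_index x2 x1z) e nth_index.
(* When [z] is empty, [T] may have no element to serve as the default of [nth]. *)
exists (perm f_inj); have [/size0nil z0|z0] := posnP (size z).
  by move: szy; rewrite z0 => /esym/size0nil ->.
have x0 : T by case: (z) z0.
apply: (@eq_from_nth _ x0); rewrite size_map // => i iz.
rewrite (nth_map x0) // permE /f mem_nth // index_uniq //.
by apply: set_nth_default; rewrite -szy.
Qed.

(** If [t] carries [z] to [y], then [t^-1 * s] gives [y] the positions that [s] gives [z]. *)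
Lemma card_induces_order_perm (n k : nat) (y z : k.-tuple 'I_n) :
  uniq y -> perm_eq z y -> (#|induces_order z| <= #|induces_order y|)%N.
Proof.
move=> uy zy; have [t tz] := exists_perm_map uy zy.
have inj : injective (fun s : 'S_n => (t^-1 * s)%g) by apply: mulgI.
rewrite -(card_image inj); apply/subset_leq_card/subsetP => _ /imageP[s sz ->].
move: sz; rewrite !unfold_in /induces_order -tz -map_comp.
by congr (sorted _ _); apply: eq_map => x /=; rewrite permM permK.
Qed.

(** Each permutation induces one of the [k!] rearrangements of [y], and none of these is induced by
    more permutations than [y] itself. *)
Lemma fact_le_card_induces_order (n k : nat) (y : k.-tuple 'I_n) :
  uniq y -> (n`! <= k`! * #|induces_order y|)%N.
Proof.
move=> uy.
pose A (z : seq 'I_n) : pred 'S_n :=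
  fun s => sorted ltn [seq nat_of_ord (s i) | i <- z].
have cov (s : 'S_n) : has (A^~ s) (permutations y).
  (* Sorting [y] by position under [s] yields the rearrangement that [s] induces. *)
  pose r := fun a b : 'I_n => (s a <= s b)%N.
  apply/hasP; exists (sort r y); first by rewrite mem_permutations perm_sort.
  rewrite /A ltn_sorted_uniq_leq map_inj_uniq ?sort_uniq ?uy /=; last first.
    by move=> a b /val_inj/perm_inj.
  by rewrite sorted_map; apply: sort_sorted => a b; apply: leq_total.
have -> : n`! = #|'S_n| by rewrite card_Sn.
have szk : size (permutations y) = k`!.
  by rewrite size_permutations // size_tuple.
have cardA z : z \in permutations y -> (#|A z| <= #|induces_order y|)%N.
  rewrite mem_permutations => zy.
  have sz : size z == k by rewrite (perm_size zy) size_tuple.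
  exact: (@card_induces_order_perm _ _ y (Tuple sz)).
rewrite -szk -sum1_card.
apply: (@leq_trans (\sum_(s : 'S_n) \sum_(z <- permutations y) A z s)).
  apply: leq_sum => s _; have /hasP[z zy zs] := cov s.
  by rewrite (big_rem z) //= zs leq_addr.
rewrite exchange_big /=.
have -> : (size (permutations y) * #|induces_order y| =
           \sum_(z <- permutations y) #|induces_order y|)%N.
  by rewrite big_const_seq count_predT iter_addn_0 mulnC.
rewrite !big_seq; apply: leq_sum => z /cardA.
by rewrite -sum1_card -big_mkcond.
Qed.

(** * Chernoff bound and union bound *)

(** Moment generating function of an indicator: the sum equals [#|T| - (1 - exp (- c)) #|A|], and
    [1 + x <= exp x] applies. *)
Lemma sum_chernoff_weight (R : realType) (T : finType) (A : pred T) (q c : R) :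
  0 <= c -> q * #|T|%:R <= #|A|%:R ->
  \sum_(t : T) expR (- (c * (A t)%:R)) <=
    #|T|%:R * expR (- (q * (1 - expR (- c)))).
Proof.
move=> c0 qA.
have -> : \sum_(t : T) expR (- (c * (A t)%:R)) =
          #|T|%:R - (1 - expR (- c)) * #|A|%:R.
  rewrite -!sum1_card !natr_sum [in X in _ - _ * X]big_mkcond mulr_sumr -sumrB.
  apply: eq_bigr => t _; rewrite unfold_in.
  by case: (A t); rewrite ?mulr1 ?mulr0 ?oppr0 ?expR0; ring.
have e1 : 0 <= 1 - expR (- c) by rewrite subr_ge0 -expR0 ler_expR oppr_le0.
have le1 := ler_wpM2l e1 qA.
have := ler_wpM2l (ler0n R #|T|) (expR_ge1Dx (- (q * (1 - expR (- c))))).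
lra.
Qed.

(** Lower-tail Chernoff bound in counting form: Markov's inequality for [exp (- c X)], where [X]
    counts the draws that land in [A]. *)
Lemma card_undersampled (R : realType) (T : finType) (A : pred T) (q d : R) (M : nat) :
  0 <= q -> 0 <= d -> q * #|T|%:R <= #|A|%:R ->
  #|[pred f : {ffun 'I_M -> T} | (\sum_j (A (f j))%:R < (1 - d) * q * M%:R :> R)]|%:R
    <= #|T|%:R ^+ M * expR (- (q * M%:R * d ^+ 2 / 4)).
Proof.
move=> q0 d0 qA; set B := [pred f | _].
(* From [1 - exp (- c) >= c - c ^ 2] the exponent per unit of [q M] is at least [c d - c ^ 2], which
   is largest at [c = d / 2]. *)
pose c : R := d / 2.
have c0 : 0 <= c by rewrite /c; lra.
have mgf : \sum_(f : {ffun 'I_M -> T}) expR (- (c * \sum_j (A (f j))%:R)) <=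
           #|T|%:R ^+ M * expR (- (q * M%:R * (1 - expR (- c)))).
  under eq_bigr do rewrite mulr_sumr -sumrN expR_sum.
  (* Independence of the draws: the sum over [f] of products factors into a product of sums. *)
  rewrite -(bigA_distr_bigA (fun _ t => expR (- (c * (A t)%:R)))) /=.
  rewrite prodr_const card_ord.
  have -> : - (q * M%:R * (1 - expR (- c))) = - (q * (1 - expR (- c))) * M%:R.
    by ring.
  rewrite expRM_natr -exprMn lerXn2r ?nnegrE ?sumr_ge0 //.
  - by move=> *; apply: expR_ge0.
  - by rewrite mulr_ge0 ?expR_ge0.
  - exact: sum_chernoff_weight.
have bad : #|B|%:R * expR (- (c * ((1 - d) * q * M%:R))) <=
    \sum_(f : {ffun 'I_M -> T}) expR (- (c * \sum_j (A (f j))%:R)).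
  rewrite (bigID B) /= -sum1_card natr_sum mulr_suml.
  rewrite ler_wpDr ?sumr_ge0 //; first by move=> *; apply: expR_ge0.
  apply: ler_sum => f Bf; rewrite mul1r ler_expR lerN2.
  by apply: ler_wpM2l => //; apply: ltW.
have {bad mgf} := le_trans bad mgf.
rewrite -ler_pdivlMr ?expR_gt0 // => /le_trans; apply.
rewrite -[leLHS]mulrA ler_wpM2l ?exprn_ge0 // -expRN -expRD ler_expR.
(* [exp (-c) <= 1 / (1 + c)] with [c = d / 2] *)
have ec : expR (- c) * (1 + c) <= 1.
  have := ler_wpM2l (expR_ge0 (- c)) (expR_ge1Dx c).
  by rewrite -expRD addNr expR0.
have e0 := expR_ge0 (- c).
have key : 0 <= (1 - expR (- c)) - c * (1 - d) - d ^+ 2 / 4.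
  have -> : d = 2 * c by rewrite /c; field.
  (* Because [(1 + c) (1 - c + c ^ 2) = 1 + c ^ 3 >= 1]. *)
  have : expR (- c) <= 1 - c + c ^+ 2 by nra.
  nra.
have := mulr_ge0 (mulr_ge0 q0 (ler0n R M)) key.
lra.
Qed.

(** If every sample failed for some [i], the failing sets would cover all [#|T| ^ M] samples, but
    their sizes add up to less. *)
Lemma exists_uniform_sample (R : realType) (T I : finType) (P : pred I) (A : I -> pred T)
    (q d : R) (M : nat) :
  (0 < #|T|)%N -> 0 <= q -> 0 <= d ->
  (forall i, P i -> q * #|T|%:R <= #|A i|%:R) ->
  #|I|%:R < expR (q * M%:R * d ^+ 2 / 4) ->
  exists f : {ffun 'I_M -> T},
    forall i, P i -> (1 - d) * q * M%:R <= \sum_j (A i (f j))%:R.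
Proof.
move=> T0 q0 d0 qA ltI.
pose B i := [pred f : {ffun 'I_M -> T} |
               (\sum_j (A i (f j))%:R < (1 - d) * q * M%:R :> R)].
have [/existsP[f /forallP good]|none] :=
  boolP [exists f, [forall i, P i ==> ~~ B i f]].
  by exists f => i Pi; have := implyP (good i) Pi; rewrite inE -leNgt.
suff: #|T|%:R ^+ M < #|T|%:R ^+ M :> R by rewrite ltxx.
have TM0 : 0 < #|T|%:R ^+ M :> R by rewrite exprn_gt0 // ltr0n.
have le_all : #|T|%:R ^+ M <= \sum_(i | P i) #|B i|%:R :> R.
  have -> : #|T|%:R ^+ M = #|{ffun 'I_M -> T}|%:R :> R.
    by rewrite card_ffun card_ord natrX.
  rewrite -natr_sum ler_nat -sum1_card.
  apply: (@leq_trans (\sum_(f : {ffun 'I_M -> T}) \sum_(i | P i) B i f)).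
    apply: leq_sum => f _.
    have /forallPn[i] : ~~ [forall i, P i ==> ~~ B i f].
      by apply: contra none => ?; apply/existsP; exists f.
    rewrite negb_imply negbK => /andP[Pi Bf].
    by rewrite (bigD1 i Pi) Bf leq_addr.
  rewrite exchange_big /=; apply: leq_sum => i _.
  by rewrite -sum1_card -big_mkcond.
apply: (le_lt_trans le_all).
apply: (@le_lt_trans _ _
  (#|I|%:R * (#|T|%:R ^+ M * expR (- (q * M%:R * d ^+ 2 / 4))))).
  rewrite mulr_natl -sumr_const big_mkcond /=.
  apply: ler_sum => i _; case: ifP => Pi.
    exact: card_undersampled q0 d0 (qA _ Pi).
  by rewrite mulr_ge0 ?expR_ge0 // ltW.
by rewrite mulrCA gtr_pMr // expRN ltr_pdivrMr ?expR_gt0 // mul1r.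
Qed.

(** * The empirical distribution of a sample and its entropy *)

Definition empirical (R : realType) (T : finType) (M : nat) (f : {ffun 'I_M -> T}) (t : T) : R :=
  \sum_j (f j == t)%:R / M%:R.

Lemma Pr_empirical (R : realType) (T : finType) (M : nat) (f : {ffun 'I_M -> T}) (E : pred T) :
  Pr (empirical R f) E = (\sum_j (E (f j))%:R) / M%:R.
Proof.
rewrite /Pr /empirical exchange_big mulr_suml /=; apply: eq_bigr => j _.
rewrite -mulr_suml big_mkcond (bigD1 (f j)) //= eqxx big1 ?addr0.
  by case: (E _).
by move=> t /negbTE tj; rewrite eq_sym tj if_same.
Qed.

Lemma empirical_distribution (R : realType) (T : finType) (M : nat) (f : {ffun 'I_M -> T}) :
  (0 < M)%N -> is_distribution (empirical R f).
Proof.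
move=> M0; split=> [t|]; first by rewrite sumr_ge0 // => j _; rewrite divr_ge0.
have := Pr_empirical R f predT; rewrite /Pr => ->.
by rewrite sumr_const card_ord divff // pnatr_eq0 -lt0n.
Qed.

Lemma ln2_gt0 (R : realType) : 0 < ln 2 :> R.
Proof. by rewrite ln_gt0 // ltr1n. Qed.

Lemma ler_log2 (R : realType) (x y : R) :
  0 < x -> 0 < y -> (log2 x <= log2 y) = (x <= y).
Proof.
by move=> x0 y0; rewrite /log2 ler_pM2r ?invr_gt0 ?ln2_gt0 // ler_ln ?posrE.
Qed.

(** Every value that occurs has mass at least [1 / M], so each [- log2 (p t)] being averaged is at
    most [log2 M]. *)
Lemma entropy_empirical (R : realType) (T : finType) (M : nat) (f : {ffun 'I_M -> T}) :
  (0 < M)%N -> entropy (empirical R f) <= log2 M%:R.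
Proof.
move=> M0; have [p0 p1] := empirical_distribution R f M0.
have MR0 : 0 < M%:R :> R by rewrite ltr0n.
rewrite /entropy -[leRHS]mul1r -[X in _ <= X * _]p1 mulr_suml -sumrN.
apply: ler_sum => t _; rewrite -mulrN; have [->|pt0] := eqVneq (empirical R f t) 0.
  by rewrite !mul0r.
apply: ler_wpM2l => //.
have : M%:R^-1 <= empirical R f t.
  have [j /eqP fj|none] := pickP (fun j => f j == t); last first.
    by case/eqP: pt0; rewrite /empirical big1 // => j _; rewrite none mul0r.
  rewrite /empirical (bigD1 j) //= fj eqxx mul1r ler_wpDr // sumr_ge0 // => i _.
  by rewrite divr_ge0.
rewrite -ler_log2 ?invr_gt0 //; last by rewrite lt_def pt0 p0.
by rewrite [log2 M%:R^-1]/log2 lnV ?posrE // mulNr lerNl.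
Qed.

(** * Elementary bounds on logarithms and factorials *)

Lemma ln2_ge (R : realType) : 1 / 2 <= ln 2 :> R.
Proof.
have := @le_ln1Dx R (- (1 / 2)) ltac:(lra).
have -> : 1 + - (1 / 2) = 2^-1 :> R by field.
by rewrite lnV ?posrE //; lra.
Qed.

Lemma ln2_le1 (R : realType) : ln 2 <= 1 :> R.
Proof. by have := @le_ln1Dx R 1 ltac:(lra); rewrite -natr1. Qed.

Lemma log2_le (R : realType) (x : R) : 0 < x -> log2 x <= 2 * x.
Proof.
move=> x0; rewrite /log2 ler_pdivrMr ?ln2_gt0 //.
have := @le_ln1Dx R (x - 1) ltac:(lra).
rewrite addrC subrK; have := ln2_ge R; nra.
Qed.

Lemma log2_expn (R : realType) (m : nat) : log2 (2 ^+ m) = m%:R :> R.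
Proof. by rewrite /log2 lnXn // -[ln 2 *+ m]mulr_natl mulfK // gt_eqF ?ln2_gt0. Qed.

Lemma log2M (R : realType) (x y : R) : 0 < x -> 0 < y -> log2 (x * y) = log2 x + log2 y.
Proof. by move=> x0 y0; rewrite /log2 lnM ?posrE // mulrDl. Qed.

Lemma log2X (R : realType) (x : R) (m : nat) : 0 < x -> log2 (x ^+ m) = m%:R * log2 x.
Proof. by move=> x0; rewrite /log2 lnXn // mulrA mulr_natl. Qed.

(** Through [k! <= k ^ k <= (2 ^ k) ^ k]. *)
Lemma fact_le_exp2 (k : nat) : (k`! <= 2 ^ (k ^ 2))%N.
Proof.
rewrite -mulnn expnM; apply: (@leq_trans (k ^ k)).
  elim: k => // k IH; rewrite factS expnS leq_mul2l /= (leq_trans IH) //.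
  by case: k {IH} => // k; rewrite leq_exp2r.
by case: k => // k; rewrite leq_exp2r // ltnW // ltn_expl.
Qed.

(** * Choice of the constants and of the sample size *)

Theorem mainTheorem8 (R : realType) :
  exists C : R, 0 < C /\
    exists N : nat, forall n : nat, (N <= n)%N ->
      forall k : nat, (0 < k)%N -> (k <= n)%N ->
        exists p : 'S_n -> R,
          [/\ is_distribution p,
              entropy p <= C * log2 (log2 n%:R)
            & uniform_induced_ordering k
                (C * k%:R ^+ 2 / log2 (log2 (log2 n%:R))) p].
Proof.
(* [n >= 16] makes the iterated logarithms at least 4, 2 and 1; 12 is what the entropy bound
   [14 + 5 L2 <= 12 L2] requires when [L2 >= 2]. *)
exists 12; split => //; exists 16%N => n n16 k k0 kn.
set L1 := log2 n%:R; set L2 := log2 L1; set L3 := log2 L2.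
set d := 12 * k%:R ^+ 2 / L3.
have n0 : 0 < n%:R :> R by rewrite ltr0n (leq_trans _ n16).
have L1_ge4 : 4 <= L1.
  by rewrite -[4](log2_expn R 4) ler_log2 ?exprn_gt0 // -natrX ler_nat.
have L1_gt0 : 0 < L1 by lra.
have L2_ge2 : 2 <= L2.
  rewrite -[2](log2_expn R 2) ler_log2 ?exprn_gt0 //.
  by apply: le_trans L1_ge4; rewrite -(natrX _ 2 2) ler_nat.
have L2_gt0 : 0 < L2 by lra.
have L3_ge1 : 1 <= L3 by rewrite -[1](log2_expn R 1) ler_log2.
have [d_ge1|d_lt1] := leP 1 d.
  (* The required probability is at most 0 here, so a point mass, of entropy at most [log2 1 = 0],
     suffices. *)
  exists (empirical R ([ffun=> 1%g] : {ffun 'I_1 -> 'S_n})); split.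
  - exact: empirical_distribution.
  - apply: le_trans (entropy_empirical _ _ _) _ => //.
    by rewrite -[1%:R](expr0 2) log2_expn; lra.
  - move=> y _; rewrite Pr_empirical.
    apply: (@le_trans _ _ 0); last by rewrite divr_ge0 // sumr_ge0.
    by rewrite mulr_le0_ge0 ?invr_ge0 //; lra.
have L3_gt0 : 0 < L3 by lra.
have k_ge1 : 1 <= k%:R :> R by rewrite ler1n.
have k2_le : 12 * k%:R ^+ 2 < L3 :> R.
  by move: d_lt1; rewrite /d ltr_pdivrMr ?mul1r //; lra.
have k_le : k%:R <= L3 by nra.
have fact_le : k`!%:R <= L2.
  apply: (@le_trans _ _ (2 ^+ (k ^ 2))).
    by rewrite -natrX ler_nat fact_le_exp2.
  by rewrite -ler_log2 ?exprn_gt0 ?log2_expn ?natrX; [rewrite -/L3; lra|lra..].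
have L2_le : L2 <= 2 * L1 by apply: log2_le; lra.
have L3_le : L3 <= 4 * L1 by apply: le_trans (log2_le _) _; lra.
have ln_le : ln n%:R <= L1.
  rewrite /L1 /log2 ler_pdivlMr ?ln2_gt0 // ger_pMr ?ln2_le1 //.
  by rewrite ln_gt0 // ltr1n (leq_trans _ n16).
pose m := (Num.truncn L1).+1.
have [m_gt m_le] : L1 < m%:R /\ m%:R <= 2 * L1.
  have /andP[lo hi] := truncn_itv (le_trans (ler0n R 4) L1_ge4).
  by split => //; rewrite /m -natr1; lra.
(* [m ^ 5] because [4 k! k (ln n) L3 ^ 2 <= 512 L1 ^ 5] and [L1 < m]. *)
pose M := (512 * m ^ 5)%N.
have M0 : (0 < M)%N by rewrite muln_gt0 expn_gt0.
have f0 : 0 < k`!%:R :> R by rewrite ltr0n fact_gt0.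
have [|||y uy||f good] := @exists_uniform_sample R 'S_n (k.-tuple 'I_n)
    (fun y => uniq y) (@induces_order n k) (k`!%:R^-1) d M.
- by rewrite card_Sn fact_gt0.
- by rewrite invr_ge0.
- by rewrite divr_ge0 //; [rewrite mulr_ge0 ?exprn_ge0|lra].
- rewrite card_Sn mulrC ler_pdivrMr // -natrM ler_nat mulnC.
  exact: fact_le_card_induces_order.
(* After taking logarithms, [n ^ k < exp (M d ^ 2 / (4 k!))] becomes a bound on [k ln n]. *)
- rewrite card_tuple card_ord natrX -[n%:R]lnK ?posrE // -expRM_natl ltr_expR.
  have -> : k`!%:R^-1 * M%:R * d ^+ 2 / 4 =
      128 * m%:R ^+ 5 * (12 * k%:R ^+ 2) ^+ 2 / (k`!%:R * L3 ^+ 2).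
    by rewrite /M /d natrM natrX; field; rewrite !gt_eqF //; lra.
  rewrite ltr_pdivlMr; last by rewrite mulr_gt0 // exprn_gt0.
  apply: (@lt_le_trans _ _ (128 * m%:R ^+ 5)); last first.
    rewrite ler_peMr ?mulr_ge0 ?exprn_ge0 // exprn_ege1 //; nra.
  (* Uses [k <= L3 <= 4 L1], [ln n <= L1] and [k! <= L2 <= 2 L1]. *)
  apply: (@le_lt_trans _ _ ((4 * L1 * L1) * (2 * L1 * (4 * L1) ^+ 2))).
    have ln0 : 0 <= ln n%:R :> R by rewrite ln_ge0 // ler1n (leq_trans _ n16).
    apply: ler_pM.
    - exact: mulr_ge0.
    - by rewrite mulr_ge0 // exprn_ge0 // ltW.
    - by apply: ler_pM => //; lra.
    - apply: ler_pM; rewrite ?(ltW f0) //; first by rewrite exprn_ge0 // ltW.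
      + by lra.
      + by rewrite lerXn2r ?nnegrE; lra.
  have -> : (4 * L1 * L1) * (2 * L1 * (4 * L1) ^+ 2) = 128 * L1 ^+ 5 by ring.
  by rewrite ltr_pM2l // ltrXn2r ?nnegrE //; lra.
have MR0 : 0 < M%:R :> R by rewrite ltr0n.
exists (empirical R f); split; first exact: empirical_distribution.
- apply: le_trans (entropy_empirical _ _ M0) _.
  (* [m <= 2 L1] gives [M <= 2 ^ 9 (2 L1) ^ 5]. *)
  apply: (@le_trans _ _ (log2 (2 ^+ 14 * L1 ^+ 5))).
    rewrite ler_log2 //; last by rewrite mulr_gt0 // exprn_gt0.
    have -> : 2 ^+ 14 * L1 ^+ 5 = 512 * (2 * L1) ^+ 5 by ring.
    by rewrite /M natrM natrX ler_pM2l // lerXn2r ?nnegrE; lra.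
  rewrite log2M ?exprn_gt0 // log2_expn log2X // -/L2; lra.
- move=> y uy; rewrite Pr_empirical ler_pdivlMr //.
  exact: good.
Qed.
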